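(* Let $k\geq 3$ and let $T$ be a $k$-tree with weighting function $\mathbf{w}:V(T)\cup E(T)\to\mathbb{C}$. Then $\lambda$ is an eigenvalue of $\mathcal{A}(T,\mathbf{w})$ if and only if there is a subtree $T'$ of $T$ such that $\lambda$ is an eigenvalue of $\mathcal{A}(T',\mathbf{w})$ (with $\mathbf{w}$ restricted to $V(T')\cup E(T')$) having a corresponding eigenvector all of whose entries are nonzero.
   Context: A $k$-graph $H$ consists of a finite vertex set $V(H)$ and a set $E(H)$ of $k$-element subsets of $V(H)$. A walk is a sequence $v_0e_1v_1\ldots e_\ell v_\ell$ with $v_{i-1},v_i\in e_i$; it is a cycle if no vertices or edges are repeated except $v_0=v_\ell$. A $k$-tree is a connected $k$-graph with no cycle; a subtree of $T$ is a $k$-graph $T'$ with $V(T')\subseteq V(T)$, $E(T')\subseteq E(T)$ that is itself a $k$-tree. For $V(H)=\{v_1,\dots,v_n\}$, the adjacency tensor $\mathcal{A}(H,\mathbf{w})=(a_{i_1\cdots i_k})$ has $a_{i\cdots i}=\mathbf{w}(v_i)$, $a_{i_1\cdots i_k}=\mathbf{w}(e)/(k-1)!$ if $\{v_{i_1},\dots,v_{i_k}\}=e\in E(H)$, and $0$ otherwise. $\lambda\in\mathbb{C}$ is an eigenvalue of a tensor $\mathcal{A}$ with eigenvector $\mathbf{x}\in\mathbb{C}^n\setminus\{0\}$ if $\sum_{i_2,\dots,i_k}a_{ii_2\cdots i_k}\mathbf{x}_{i_2}\cdots\mathbf{x}_{i_k}=\lambda\mathbf{x}_i^{k-1}$ for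 all $i$. *)

(* Defs.v *)
From mathcomp Require Import all_boot all_order all_algebra.
From mathcomp Require Import reals complex.

Set Implicit Arguments.
Unset Strict Implicit.
Unset Printing Implicit Defensive.

Import GRing.Theory.
Local Open Scope ring_scope.

(* Vertex sets are subsets of an ambient finite type [V], so that a k-graph
   and its subgraphs live in the same type. *)
Record kgraph (k : nat) (V : finType) := KGraph {
  verts : {set V};
  edges : {set {set V}};
  edge_sub : forall e, e \in edges -> e \subset verts;
  edge_card : forall e, e \in edges -> #|e| = k
}.

Section KGraphs.
Context {k : nat} {V : finType}.
Implicit Types (H T : kgraph k V) (v : V) (p : seq ({set V} * V)).

(* The walk v_0 e_1 v_1 ... e_l v_l is encoded by v = v_0 and
   p = [:: (e_1, v_1); ...; (e_l, v_l)]. *)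
Fixpoint steps H v p : bool :=
  if p is (e, u) :: p' then
    [&& e \in edges H, v \in e, u \in e & steps H u p']
  else true.

Definition walk H v p : bool := (v \in verts H) && steps H v p.

Definition walk_end v p : V := last v (unzip2 p).

(* When l = 1, a one-edge walk v e v repeats nothing but its endpoint, so
   length at least 2 has to be required explicitly. Length 2 is allowed: two
   distinct edges sharing two vertices form a cycle. Since v_0 = v_l, the
   list v_1, ..., v_l contains every vertex of the walk. *)
Definition hcycle H v p : bool :=
  [&& walk H v p, (2 <= size p)%N, walk_end v p == v,
      uniq (unzip1 p) & uniq (unzip2 p)].

Definition hconnected H : Prop :=
  {in verts H &, forall u v, exists2 p, walk H u p & walk_end u p = v}.

Definition ktree H : Prop :=
  hconnected H /\ ~ (exists v p, hcycle H v p).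

Definition subtree T' T : Prop :=
  [/\ verts T' \subset verts T, edges T' \subset edges T & ktree T'].

End KGraphs.

Definition tensor (F : Type) (k n : nat) := {ffun k.-tuple 'I_n -> F}.

Section Eigen.
Context {F : fieldType} {k n : nat}.

(* The sum ranges over the index tuples (i_1, ..., i_k) with i_1 = i. *)
Definition eigenpair (A : tensor F k n) (lam : F) (x : 'rV[F]_n) : Prop :=
  x != 0 /\
  forall i : 'I_n,
    \sum_(t : k.-tuple 'I_n | ohead t == Some i)
       A t * \prod_(j <- behead t) x 0 j = lam * x 0 i ^+ k.-1.

Definition tensor_eigenvalue (A : tensor F k n) (lam : F) : Prop :=
  exists x, eigenpair A lam x.

End Eigen.

(* The vertices of [H] are numbered by [enum_val : 'I_#|verts H| -> V]. The
   weighting [w] is total on [V + {set V}], but only its values on [verts H]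
   and [edges H] are used; so for a subgraph [T'] of [T], the tensor
   [adj_tensor T' w] is that of the restriction of [w] to [T']. *)
Definition adj_tensor (F : fieldType) (k : nat) (V : finType)
    (H : kgraph k V) (w : V + {set V} -> F) : tensor F k #|verts H| :=
  [ffun t : k.-tuple 'I_#|verts H| =>
     let e := [set enum_val i | i in t] in
     if [pick i | t == [tuple of nseq k i]] is Some i then w (inl (enum_val i))
     else if e \in edges H then w (inr e) / (k.-1)`!%:R
     else 0].

(* Main.v *)
(** In a tree, an edge outside a subtree [T'] meets [T'] in at most one vertex,
    since otherwise it would close a cycle with a path in [T'].  As edges have
    at least three vertices, extending an eigenvector of [T'] by zero therefore
    adds only vanishing terms to the eigenvalue equations.  Conversely, an
    eigenvector of [T] is nowhere zero on a connected component of the subgraph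
    induced by its support, and an edge leaving that component contains a
    zero of the eigenvector. *)
Require Import Defs.
From mathcomp Require Import all_boot all_order all_algebra.
From mathcomp Require Import reals complex.

Set Implicit Arguments.
Unset Strict Implicit.
Unset Printing Implicit Defensive.

Import GRing.Theory Num.Theory.
Local Open Scope ring_scope.
Local Open Scope complex_scope.

(** * Simple walks and cycles *)

Section Paths.
Variables (k : nat) (V : finType).
Implicit Types (H T : kgraph k V) (u v : V) (e : {set V}).
Implicit Types p q : seq ({set V} * V).

(** Unlike in [hcycle], the start [v] must also differ from the later vertices, so that one new edge
    back to [v] can close the walk to a cycle. *)
Definition simple_walk H v p : bool :=
  [&& steps H v p, uniq (v :: unzip2 p) & uniq (unzip1 p)].

Lemma steps_mem_edge H v p u :
  steps H v p -> u \in unzip2 p -> exists2 e, e \in unzip1 p & u \in e.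
Proof.
elim: p v => [|[e b] p IH] v //= /and4P[_ _ be st].
rewrite inE => /predU1P[->|/(IH _ st)[f fp uf]]; first by exists e; rewrite ?mem_head.
by exists f; rewrite // inE fp orbT.
Qed.

Lemma steps_edges H v p : steps H v p -> {subset unzip1 p <= edges H}.
Proof.
elim: p v => [|[e b] p IH] v //= /and4P[eH _ _ /IH st] f.
by rewrite inE => /predU1P[->|/st].
Qed.

Lemma steps_sub H T v p :
  edges H \subset edges T -> steps H v p -> steps T v p.
Proof.
move=> /subsetP sHT; elim: p v => [|[e b] p IH] v //= /and4P[eH -> -> /IH ->].
by rewrite sHT.
Qed.

Lemma steps_cat H v p q :
  steps H v (p ++ q) = steps H v p && steps H (walk_end v p) q.
Proof. by elim: p v => [|[e b] p IH] v //=; rewrite IH !andbA. Qed.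

(** Every later vertex of [q] lies in an edge of [q], and [u] lies in none of these, so [u] is not
    repeated; nor is [e], which contains [u]. *)
Lemma simple_walk_cons H u e a q :
    e \in edges H -> u \in e -> a \in e -> u != a ->
    ~~ has (fun f : {set V} => u \in f) (unzip1 q) ->
  simple_walk H a q -> simple_walk H u ((e, a) :: q).
Proof.
move=> eH ue ae ua /hasPn nu /and3P[st un ue1].
rewrite /simple_walk /= eH ue ae st inE (negPf ua) ue1 !andbT /=.
move: un => /= ->; rewrite andbT; apply/andP; split.
  by apply/negP => /(steps_mem_edge st)[f /nu /negP].
by apply/negP => /nu; rewrite ue.
Qed.

(** Cutting at repeated vertices alone could leave repeated edges. The walk is instead entered at
    its last edge containing [u]; if that edge leads to [u] itself, the remainder suffices. *)
Lemma simple_walk_last_edge H u a q :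
    has (fun f : {set V} => u \in f) (unzip1 q) -> simple_walk H a q ->
  exists2 p, simple_walk H u p & walk_end u p = walk_end a q.
Proof.
elim: q a => [|[f b] q IH] a //= hq /and3P[/= /and4P[fH af bf st]].
case/andP=> [_ ub] /andP[_ ue].
have sq : simple_walk H b q by apply/and3P.
have [hq'|nq] := boolP (has (fun f : {set V} => u \in f) (unzip1 q)).
  exact: IH hq' sq.
rewrite (negPf nq) orbF in hq.
have [->|nub] := eqVneq u b; first by exists q.
by exists ((f, b) :: q) => //; apply: simple_walk_cons.
Qed.

Lemma steps_simple H u p : steps H u p ->
  exists2 q, simple_walk H u q & walk_end u q = walk_end u p.
Proof.
elim: p u => [|[e a] p IH] u /=; first by exists [::].
case/and4P=> eH ue ae /IH[q sq endq].
have -> : walk_end u ((e, a) :: p) = walk_end a p by [].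
rewrite -endq.
have [hq|nq] := boolP (has (fun f : {set V} => u \in f) (unzip1 q)).
  exact: simple_walk_last_edge hq sq.
have [->|nua] := eqVneq u a; first by exists q.
by exists ((e, a) :: q) => //; apply: simple_walk_cons.
Qed.

(** A simple walk in [T'] from [u] to [v] avoids [e], so appending [e] would close it to a cycle of
    [T]. *)
Lemma subtree_edge_meet T T' e u v :
    ktree T -> subtree T' T -> e \in edges T -> e \notin edges T' ->
    u \in e -> v \in e -> u \in verts T' -> v \in verts T' -> u = v.
Proof.
move=> [_ acyc] [sV sE [conn _]] eT eT' ue ve uT vT.
apply/eqP; apply: contraT => nuv; case: acyc.
have [p0 /andP[_ /steps_simple[p /and3P[st un ue1]]] endp0 endp] := conn u v uT vT.
rewrite -{p0}endp0 in endp.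
exists u, (rcons p (e, u)); apply/and5P; split.
- rewrite /walk (subsetP sV) // -cats1 steps_cat (steps_sub sE st) endp /=.
  by rewrite eT ve ue.
(* An empty walk would give [u = v]; hence the closed walk has length at least 2. *)
- by case: p endp {st un ue1} => [endp|]; [rewrite -endp eqxx in nuv|move=> ? []].
- by rewrite /walk_end /unzip2 map_rcons last_rcons.
- rewrite /unzip1 map_rcons rcons_uniq ue1 andbT.
  by apply: contra eT' => /(steps_edges st).
- by rewrite /unzip2 map_rcons rcons_uniq.
Qed.

(** Acyclicity is inherited, because a cycle of [T'] is a cycle of [T]. *)
Lemma ktree_sub_connected T T' :
    ktree T -> verts T' \subset verts T -> edges T' \subset edges T ->
  hconnected T' -> subtree T' T.
Proof.
move=> [_ acyc] sV sE conn; split=> //; split=> // -[v [p]].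
case/and5P=> /andP[vT st] sz en u1 u2; case: acyc; exists v, p; apply/and5P.
by split=> //; rewrite /walk (subsetP sV) //= (steps_sub sE).
Qed.

End Paths.

(** * The component of a vertex in an induced subgraph *)

Section Component.
Variables (k : nat) (V : finType) (T : kgraph k V) (S : {set V}) (v : V).
Hypotheses (vS : v \in S) (vT : v \in verts T).

(** An edge counts only if it lies wholly inside [S]: this is adjacency in the subgraph induced by
    [S]. *)
Definition adj_in : rel V :=
  fun a b => [exists e in edges T, [&& e \subset S, a \in e & b \in e]].

Definition component_verts : {set V} := [set u | connect adj_in v u].

Definition component_edges : {set {set V}} :=
  [set e in edges T | e \subset component_verts].

Fact component_edge_sub e : e \in component_edges -> e \subset component_verts.
Proof. by rewrite inE => /andP[]. Qed.

Fact component_edge_card e : e \in component_edges -> #|e| = k.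
Proof. by rewrite inE => /andP[/edge_card]. Qed.

Definition component : kgraph k V :=
  KGraph component_edge_sub component_edge_card.

Lemma adj_in_sym : symmetric adj_in.
Proof.
by move=> a b; apply: eq_existsb => e; rewrite [(a \in e) && _]andbC.
Qed.

Lemma component_sub : component_verts \subset S :&: verts T.
Proof.
apply/subsetP => u; rewrite !inE => /connectP[p].
elim/last_ind: p u => [|p b _] u; first by move=> _ ->; rewrite vS vT.
rewrite rcons_path last_rcons => /andP[_ /existsP[e]] /and4P[eT eS _ be] ->.
by rewrite (subsetP eS) // (subsetP (edge_sub eT)).
Qed.

(** Maximality of the component, used in the form that an edge of [T] meeting it without belonging
    to it has a vertex outside [S]. *)
Lemma component_edge_closed e u : e \in edges T -> e \subset S -> u \in e ->
  u \in component_verts -> e \in component_edges.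
Proof.
move=> eT eS ue; rewrite !inE eT => uC; apply/subsetP => b be.
rewrite inE; apply: connect_trans uC (connect1 _).
by apply/existsP; exists e; rewrite eT eS ue be.
Qed.

Lemma component_connected : hconnected component.
Proof.
move=> a b /= aC; rewrite /= inE => bC.
have: connect adj_in a b.
  apply: connect_trans bC.
  by rewrite sym_connect_sym; [move: aC; rewrite inE|exact: adj_in_sym].
case/connectP=> p pth bE.
(* Each adjacency along the path supplies an edge, which belongs to the component since its first
   vertex does. *)
elim: p a aC pth bE => [|c p IH] a aC /=.
  by move=> _ ->; exists [::] => //; rewrite /walk aC.
case/andP=> /existsP[e /and4P[eT eS ae ce]] pth bE.
have eC := component_edge_closed eT eS ae aC.
have cC : c \in component_verts by apply: (subsetP (component_edge_sub eC)).
have [q /andP[_ st] endq] := IH c cC pth bE.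
by exists ((e, c) :: q) => //; rewrite /walk aC /= eC ae ce.
Qed.

End Component.

(** * Eigenvalue equations as sums over edges *)

Section AdjacencyTensor.
Variables (F : numFieldType) (m : nat) (V : finType).
Variables (H : kgraph m.+1 V) (w : V + {set V} -> F).
Hypothesis m_gt0 : (0 < m)%N.
Let n := #|verts H|.
Implicit Types (i j : 'I_n) (s : m.-tuple 'I_n) (e : {set V}).

Lemma sum_tuple_ohead (A : m.+1.-tuple 'I_n -> F) i :
  \sum_(t : m.+1.-tuple 'I_n | ohead t == Some i) A t =
  \sum_(s : m.-tuple 'I_n) A [tuple of i :: s].
Proof.
rewrite (reindex (fun s : m.-tuple 'I_n => [tuple of i :: s])) /=.
  by apply: eq_bigl => s; rewrite eqxx.
exists (fun t : m.+1.-tuple 'I_n => [tuple of behead t]) => [s _|t].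
  exact/val_inj.
case/tupleP: t => a s; rewrite inE /= => /eqP[->].
exact/val_inj.
Qed.

Lemma adj_tensor_diag i :
  adj_tensor H w [tuple of i :: nseq m i] = w (inl (enum_val i)).
Proof.
rewrite ffunE; case: pickP => [j /eqP/(congr1 val)/= [->]//|/(_ i)].
by case/eqP; apply/val_inj.
Qed.

Lemma adj_tensor_offdiag i s : s != [tuple of nseq m i] ->
  let e := [set enum_val j | j in i :: s] in
  adj_tensor H w [tuple of i :: s] =
  if e \in edges H then w (inr e) / m`!%:R else 0.
Proof.
move=> sN /=; rewrite ffunE; case: pickP => [j /eqP/(congr1 val)/= [ij sE]|_ //].
by case/eqP: sN; apply/val_inj; rewrite /= sE ij.
Qed.

(** The tuple [i :: s] has [m.+1] entries, as many as [e] has vertices, so it covers [e] exactly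
    when its entries are distinct and lie in [e]. *)
Lemma edge_tupleP i e s : e \in edges H -> enum_val i \in e ->
  ([set enum_val j | j in i :: s] == e) =
  (all [pred j | enum_val j \in e :\ enum_val i] s && uniq s).
Proof.
move=> eH ie; have ec := edge_card eH.
apply/eqP/andP => [eE|[/allP sA us]].
  have ucons : uniq (i :: s).
    apply/card_uniqP; rewrite /= size_tuple -ec -eE card_imset //.
    exact: enum_val_inj.
  move: ucons; rewrite cons_uniq => /andP[iNs us]; split=> //; apply/allP => j js /=.
  rewrite !inE (inj_eq enum_val_inj) -eE imset_f ?inE ?js ?orbT // andbT.
  by apply: contraNneq iNs => <-.
apply/eqP; rewrite eqEcard; apply/andP; split.
  apply/subsetP => _ /imsetP[j jis ->]; move: jis.
  by rewrite inE => /predU1P[->//|/sA]; rewrite !inE => /andP[].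
rewrite card_imset; last exact: enum_val_inj.
have /card_uniqP -> : uniq (i :: s).
  rewrite /= us andbT; apply/negP => /sA; rewrite !inE eqxx //.
by rewrite /= size_tuple ec.
Qed.

(** The tuples are the $m!$ orderings of [e] without the vertex of [i], and all give the same
    product. *)
Lemma sum_edge_tuples (y : V -> F) i e : e \in edges H ->
  \sum_(s : m.-tuple 'I_n | [set enum_val j | j in i :: s] == e)
     \prod_(j <- s) y (enum_val j) =
  if enum_val i \in e then (\prod_(u in e :\ enum_val i) y u) *+ m`! else 0.
Proof.
move=> eH; case: ifPn => [ie|iNe]; last first.
  apply: big1 => s /eqP eE; case/negP: iNe.
  by rewrite -eE imset_f // mem_head.
rewrite (eq_bigl _ _ (fun s => edge_tupleP s eH ie)).
set D := [pred j : 'I_n | enum_val j \in e :\ enum_val i].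
have imD : e :\ enum_val i = [set enum_val j | j in D].
  apply/setP => u; apply/idP/imsetP => [uD|[j jD ->]]; last by [].
  have uH : u \in verts H.
    by apply: (subsetP (edge_sub eH)); move: uD; rewrite inE => /andP[].
  exists (enum_rank_in uH u); last by rewrite enum_rankK_in.
  by rewrite inE /= enum_rankK_in.
have cD : #|D| = m.
  rewrite -(card_imset _ enum_val_inj) -imD.
  by have := edge_card eH; rewrite (cardsD1 (enum_val i)) ie => -[].
have prodE s : all D s && uniq s ->
    \prod_(j <- s) y (enum_val j) = \prod_(u in e :\ enum_val i) y u.
  case/andP=> /allP sD us.
  rewrite imD big_imset /=; last by move=> ? ? _ _; apply: enum_val_inj.
  rewrite big_uniq //; apply: eq_bigl => j.
  have /subset_cardP eqsD : #|s| = #|D|.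
    by rewrite cD (card_uniqP us) size_tuple.
  by apply: eqsD; apply/subsetP => b /sD.
(* The falling factorial [m ^_ m] counts the duplicate-free [m]-tuples with entries in the [m]-set
   [D]. *)
rewrite (eq_bigr _ prodE) sumr_const -(ffactnn m) -[X in (X ^_ _)%N]cD.
by rewrite -card_uniq_tuples; congr (_ *+ _); apply: eq_card => s; rewrite !inE.
Qed.

(** The diagonal tuple yields the vertex weight. The others are grouped by the edge they span, and
    the number of orderings cancels the factorial in the tensor. *)
Lemma adj_tensor_sum (y : V -> F) i :
  \sum_(t : m.+1.-tuple 'I_n | ohead t == Some i)
     adj_tensor H w t * \prod_(j <- behead t) y (enum_val j) =
  w (inl (enum_val i)) * y (enum_val i) ^+ m +
  \sum_(e in edges H | enum_val i \in e)
     w (inr e) * \prod_(u in e :\ enum_val i) y u.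
Proof.
rewrite sum_tuple_ohead (bigD1 [tuple of nseq m i]) //=; congr (_ + _).
  by rewrite adj_tensor_diag big_nseq -Monoid.iteropE.
pose im s := [set enum_val j | j in i :: s].
(* The inner sum has at most one term, the edge spanned by [s]; in this form the two sums can be
   exchanged. *)
transitivity (\sum_(s : m.-tuple 'I_n) \sum_(e in edges H | im s == e)
    w (inr e) / m`!%:R * \prod_(j <- s) y (enum_val j)).
  (* The diagonal tuple, now included on the right, contributes nothing: it spans one vertex, and
     edges have at least two. *)
  rewrite [RHS](bigD1 [tuple of nseq m i]) //= [X in _ = X + _]big1 ?add0r; last first.
    move=> e /andP[/edge_card ec /eqP eE].
    suff [m0] : m.+1 = 1%N by case/eqP: (lt0n_neq0 m_gt0).
    rewrite -ec -eE -(cards1 (enum_val i)); congr #|pred_of_set _|.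
    apply/setP => u; rewrite inE; apply/imsetP/eqP => [[j]|->]; last first.
      by exists i; rewrite ?mem_head.
    by rewrite inE mem_nseq => /predU1P[->|/andP[_ /eqP ->]].
  apply: eq_bigr => s sN; rewrite adj_tensor_offdiag // -/(im s).
  case: ifPn => [imH|imN].
    rewrite (big_pred1 (im s)) // => e.
    by rewrite /= [RHS]eq_sym; case: eqP => [<-|]; rewrite ?imH ?andbF.
  by rewrite mul0r big_pred0 // => e; apply/andP => -[eH /eqP eE]; rewrite eE eH in imN.
rewrite (exchange_big_dep (mem (edges H))) /=; last by move=> s e _ /andP[].
rewrite big_mkcondr; apply: eq_bigr => e eH.
rewrite (eq_bigl (fun s : m.-tuple 'I_n => im s == e)) => [|s]; last by rewrite eH.
rewrite -mulr_sumr sum_edge_tuples //; case: ifP => _; last by rewrite mulr0.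
(* The factorial is invertible in characteristic zero. *)
by rewrite mulrnAr -mulrnAl -[_ / _ *+ _]mulr_natr divfK // pnatr_eq0 -lt0n fact_gt0.
Qed.

(** The tensors of a graph and of its subgraph have different index types; stated for functions on
    [V], their equations can be compared on one and the same [y]. *)
Lemma adj_eigenpairP (y : V -> F) (x : 'rV[F]_n) lam :
  (forall i, x 0 i = y (enum_val i)) ->
  eigenpair (adj_tensor H w) lam x <->
  (exists2 v, v \in verts H & y v != 0) /\
  {in verts H, forall v,
     w (inl v) * y v ^+ m +
     \sum_(e in edges H | v \in e) w (inr e) * \prod_(u in e :\ v) y u =
     lam * y v ^+ m}.
Proof.
move=> xE.
have sumE i : \sum_(t : m.+1.-tuple 'I_n | ohead t == Some i)
     adj_tensor H w t * \prod_(j <- behead t) x 0 j =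
  \sum_(t : m.+1.-tuple 'I_n | ohead t == Some i)
     adj_tensor H w t * \prod_(j <- behead t) y (enum_val j).
  by apply: eq_bigr => t _; congr (_ * _); apply: eq_bigr => j _.
split=> [[xN eqs]|[[v vH yv] eqs]]; split.
- have [i xi] : exists i, x 0 i != 0.
    apply/existsP; apply: contraNT xN; rewrite negb_exists => /forallP x0.
    by apply/eqP/rowP => i; rewrite mxE; apply/eqP; rewrite -[_ == _]negbK.
  by exists (enum_val i); rewrite ?enum_valP // -xE.
- move=> v vH; have := eqs (enum_rank_in vH v).
  by rewrite sumE adj_tensor_sum xE enum_rankK_in.
- apply: contraNneq yv => x0; rewrite -(enum_rankK_in vH vH) -xE x0.
  by rewrite mxE.
- by move=> i; rewrite sumE adj_tensor_sum eqs ?enum_valP // xE.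
Qed.

End AdjacencyTensor.

(** * Extension of vectors by zero *)

Section Extension.
Variables (F : numFieldType) (V : finType).

Definition extend_row (H : {set V}) (x : 'rV[F]_#|H|) (v : V) : F :=
  if [pick i | enum_val i == v] is Some i then x 0 i else 0.

Lemma extend_rowE (H : {set V}) (x : 'rV[F]_#|H|) i :
  extend_row x (enum_val i) = x 0 i.
Proof.
rewrite /extend_row; case: pickP => [j /eqP/enum_val_inj->//|/(_ i)].
by rewrite eqxx.
Qed.

Lemma extend_row_out (H : {set V}) (x : 'rV[F]_#|H|) v :
  v \notin H -> extend_row x v = 0.
Proof.
rewrite /extend_row; case: pickP => [j /eqP <-|//].
by rewrite enum_valP.
Qed.

End Extension.

(** * Transfer of eigenvectors between a tree and its subtrees *)

Theorem theorem2p4 (R : realType) (k : nat) (hk : (3 <= k)%N) (V : finType)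
    (T : kgraph k V) (hT : ktree T) (w : V + {set V} -> R[i]) (lam : R[i]) :
  tensor_eigenvalue (adj_tensor T w) lam <->
  exists T' : kgraph k V,
    subtree T' T /\
    exists x : 'rV[R[i]]_(#|verts T'|),
      eigenpair (adj_tensor T' w) lam x /\ forall i, x 0 i != 0.
Proof.
case: k hk T hT => // m m_gt1 T hT; have m_gt0 : (0 < m)%N by apply: ltnW.
split=> [[x xeig]|[T' [sT' [x [xeig xN]]]]].
  pose y := extend_row x.
  have [[v vT yv] eqs] := iffLR
    (adj_eigenpairP w m_gt0 lam (fun i => esym (extend_rowE x i))) xeig.
  rewrite -/y in yv eqs.
  pose S := [set u | y u != 0]; have vS : v \in S by rewrite inE.
  have /subsetP subC := component_sub vS vT.
  exists (component T S v); split.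
    apply: (ktree_sub_connected hT _ _ (@component_connected _ _ _ _ _)).
      by apply/subsetP => u /subC; rewrite inE => /andP[].
    by apply/subsetP => e; rewrite inE => /andP[].
  exists (\row_i y (enum_val i)); split=> [|i]; last first.
    by have := subC _ (enum_valP i); rewrite mxE !inE => /andP[].
  apply/(@adj_eigenpairP _ _ _ _ _ m_gt0 y) => [i|]; first by rewrite mxE.
  split; first by exists v => //; rewrite inE connect0.
  move=> u uC; have := subC _ uC; rewrite !inE => /andP[yu uT].
  rewrite -(eqs u uT); congr (_ + _).
  rewrite [RHS](bigID (mem (component_edges T S v))) /= [X in _ = _ + X]big1 ?addr0.
    apply: eq_bigl => e /=; rewrite andbC [RHS]andbAC [RHS]andbC; congr andb.
    by rewrite inE andbA andbb.
  move=> e /andP[/andP[eT ue] eNC].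
  (* The edge meets the component at [u] without belonging to it, so it leaves the support of [y].
     Its zero [b] differs from [u] and is thus a factor of the product. *)
  have /subsetPn[b be] : ~~ (e \subset S).
    by apply: contra eNC => eS; apply: component_edge_closed eS ue uC.
  rewrite inE negbK => /eqP yb; rewrite (bigD1 b) /= ?yb ?mul0r ?mulr0 //.
  rewrite !inE be andbT.
  by apply: contraNneq yu => <-; rewrite yb.
have [[v vT' yv] eqs] := iffLR
  (adj_eigenpairP w m_gt0 lam (fun i => esym (extend_rowE x i))) xeig.
set y := extend_row x in yv eqs.
have [sV sE _] := sT'.
exists (\row_i y (enum_val i)).
apply/(@adj_eigenpairP _ _ _ _ _ m_gt0 y) => [i|]; first by rewrite mxE.
split=> [|u uT]; first by exists v; rewrite ?(subsetP sV).
have out e : e \in edges T -> e \notin edges T' -> u \in e ->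
    \prod_(b in e :\ u) y b = 0.
  move=> eT eT' ue.
  (* As [k >= 3], [e] has two vertices besides [u], of which at most one is in [T']; the other
     carries the value 0. This covers [u] inside and outside [T'] alike. *)
  have : (1 < #|e :\ u|)%N.
    by have := edge_card eT; rewrite (cardsD1 u) ue add1n => -[->].
  case/card_gt1P=> [a [b [ae be ab]]].
  have [c ce cT'] : exists2 c, c \in e :\ u & c \notin verts T'.
    have [aT'|] := boolP (a \in verts T'); last by exists a.
    exists b => //; apply: contra ab => bT'; apply/eqP.
    move: ae be; rewrite !inE => /andP[_ ae] /andP[_ be].
    exact: subtree_edge_meet hT sT' eT eT' ae be aT' bT'.
  by rewrite (bigD1 c) //= [y c]extend_row_out ?mul0r.
rewrite (bigID (mem (edges T'))) /= [X in _ + (_ + X)]big1 ?addr0; last first.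
  by move=> e /andP[/andP[eT ue] eT']; rewrite out ?mulr0.
have [uT'|uT'] := boolP (u \in verts T').
  rewrite -(eqs u uT'); congr (_ + _); apply: eq_bigl => e.
  by have [/(subsetP sE)->|] := boolP (e \in edges T'); rewrite ?andbF ?andbT.
(* Outside [T'] both sides vanish: [y u = 0] is raised to the positive power [m], and no edge of
   [T'] contains [u]. *)
rewrite [y u]extend_row_out // expr0n gtn_eqF // !mulr0 add0r big1 // => e.
case/andP=> /andP[_ ue] eT'.
by case/negP: uT'; apply: (subsetP (edge_sub eT')).
Qed.
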